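(* Let $F$ be a finitely generated non-abelian free group with finite basis $A$ and let $\varphi$ be an automorphism of $F$. (a) For any $u\in F(A)$ there exists a finite set $U\subset F(A)$ such that $\varphi(C^1_u)=C^1_U$. (b) A set $U$ as in (a) can be algorithmically derived from $u\in F(A)$ and from the words in the finite subsets $\varphi(A)$ and $\varphi^{-1}(A)$ of $F(A)$. Indeed, the equality $\varphi(C^1_u)=C^1_U$ is true for $$U=\{\varphi(u')|_{S(\varphi)^2}\mid u'\in u|^k\},\qquad k=S(\varphi)^4+S(\varphi)^3+S(\varphi)^2 .$$
   Context: $F(A)$ denotes the set of finite reduced words in $A\cup A^{-1}$, identified with $F$; $|w|$ is the word length of $w\in F(A)$. The Gromov boundary $\partial F$ is identified with the set $\partial F(A)$ of infinite reduced words $x_1x_2x_3\cdots$ ($x_i\in A\cup A^{-1}$, $x_i\neq x_{i+1}^{-1}$). Every automorphism $\varphi$ of $F$ induces canonically a homeomorphism of $\partial F$, also denoted $\varphi$. For $u\in F(A)$ the cylinder $C^1_u\subset\partial F$ is the set of all infinite reduced words having $u$ as prefix. For a subset $U\subset F(A)$, $C^1_U=\bigcup_{u\in U}C^1_u$. $S(\varphi)$ is the maximal length $|\varphi(a_i)|$ or $|\varphi^{-1}(a_i)|$ among all $a_i\in A$. For a reduced word $w\in F(A)$ and an integer $l\geq 0$, $w|_l$ denotes the word obtained from $w$ by erasing the last $l$ letters (for $l\le |w|$), and $w|^l$ denotes the set of reduced words obtained from $w$ by adding $l$ letters from $A\cup A^{-1}$ at the end of $w$. In $\varphi(u')|_l$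 the element $\varphi(u')$ is first written as a reduced word. *)

(* Defs.v *)
From HB Require Import structures.
From mathcomp Require Import all_boot.
From mathcomp Require Import boolp classical_sets cardinality.

Set Implicit Arguments.
Unset Strict Implicit.
Unset Printing Implicit Defensive.

Local Open Scope classical_set_scope.

(* (a, true) is the basis element a, (a, false) is its formal inverse. *)
Notation letter A := (A * bool)%type.

Definition linv (A : finType) (x : letter A) : letter A := (x.1, ~~ x.2).

Definition reduced (A : finType) (w : seq (letter A)) : bool :=
  sorted (fun x y => y != linv x) w.

Definition red_cons (A : finType) (x : letter A) (w : seq (letter A)) :=
  if w is y :: w' then if y == linv x then w' else x :: w else [:: x].

Definition reduce (A : finType) (w : seq (letter A)) : seq (letter A) :=
  foldr (@red_cons A) [::] w.

Record fword (A : finType) : Type := FWord {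
  fword_seq :> seq (letter A);
  fwordP : reduced fword_seq
}.
HB.instance Definition _ (A : finType) := [isSub for @fword_seq A].
HB.instance Definition _ (A : finType) := [Choice of fword A by <:].

Section FreeGroup.
Variable A : finType.
Implicit Types (x y : letter A) (u v w : seq (letter A)).

Lemma linvK : involutive (@linv A).
Proof. by case=> a b; rewrite /linv /= negbK. Qed.

Lemma linv_eqC x y : (y == linv x) = (x == linv y).
Proof. by apply/eqP/eqP=> ->; rewrite linvK. Qed.

Lemma reduced_cons x w :
  reduced (x :: w) = (if w is y :: _ then y != linv x else true) && reduced w.
Proof. by case: w. Qed.

Lemma red_cons_reduced x w : reduced w -> reduced (red_cons x w).
Proof.
case: w => [|y w] //= yw; case: eqP => [_|/eqP xy]; last by rewrite /= xy.
exact: path_sorted yw.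
Qed.

Lemma reduce_reduced w : reduced (reduce w).
Proof. by elim: w => //= x w; apply: red_cons_reduced. Qed.

Lemma reduce_id w : reduced w -> reduce w = w.
Proof.
elim: w => // x w IH; rewrite reduced_cons => /andP[xw rw].
by rewrite /= IH //; case: w xw {IH rw} => //= y w /negbTE ->.
Qed.

Lemma red_consK x w : reduced w -> red_cons x (red_cons (linv x) w) = w.
Proof.
case: w => [_|y w] /=; first by rewrite eqxx.
rewrite linvK; case: eqP => [->|_ _]; last by rewrite /= eqxx.
case: w => //= z w /andP[/negbTE zx _]; first by rewrite zx.
Qed.

Lemma reduce_catr u v : reduce (u ++ reduce v) = reduce (u ++ v).
Proof.
by rewrite /reduce !foldr_cat -/(reduce v) -/(reduce _) reduce_id // reduce_reduced.
Qed.

Lemma reduce_red_cons x u v :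
  reduced u -> reduce (red_cons x u ++ v) = red_cons x (reduce (u ++ v)).
Proof.
case: u => [|y u] //= yu; case: eqP => [->|_] //=.
by rewrite red_consK // reduce_reduced.
Qed.

Lemma reduce_catl u v : reduce (reduce u ++ v) = reduce (u ++ v).
Proof.
elim: u => //= x u IH.
by rewrite reduce_red_cons ?reduce_reduced // IH.
Qed.

Definition winv w := rev (map (@linv A) w).

Lemma winv_cons x w : winv (x :: w) = rcons (winv w) (linv x).
Proof. by rewrite /winv /= rev_cons. Qed.

Lemma winvK : involutive winv.
Proof. by move=> w; rewrite /winv map_rev revK mapK //; apply: linvK. Qed.

Lemma size_winv w : size (winv w) = size w.
Proof. by rewrite size_rev size_map. Qed.

Lemma winv_reduced w : reduced w -> reduced (winv w).
Proof.
move=> rw; rewrite /reduced /winv rev_sorted sorted_map.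
by apply: sub_sorted rw => x y /=; rewrite linvK eq_sym.
Qed.

Lemma reduce_winv w : reduce (winv w ++ w) = [::].
Proof.
elim: w => // x w IH.
have e : reduce [:: linv x, x & w] = reduce w.
  by rewrite /= -{2}(linvK x) red_consK ?reduce_reduced.
by rewrite winv_cons cat_rcons -reduce_catr e reduce_catr.
Qed.

Definition fmul (u v : fword A) : fword A := FWord (reduce_reduced (u ++ v)).
Definition fone : fword A := @FWord A [::] isT.
Definition finv (u : fword A) : fword A := FWord (winv_reduced (fwordP u)).

Lemma fmulA : associative fmul.
Proof.
by move=> u v w; apply: val_inj; rewrite /= reduce_catr reduce_catl catA.
Qed.

Lemma fmul1 : left_id fone fmul.
Proof. by move=> u; apply: val_inj; rewrite /= reduce_id // fwordP. Qed.

Lemma f1mul : right_id fone fmul.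
Proof. by move=> u; apply: val_inj; rewrite /= cats0 reduce_id // fwordP. Qed.

Lemma fmulVg : left_inverse fone finv fmul.
Proof. by move=> u; apply: val_inj; rewrite /= reduce_winv. Qed.

Lemma fmulgV : right_inverse fone finv fmul.
Proof.
move=> u; apply: val_inj => /=.
by rewrite -{1}(winvK u) reduce_winv.
Qed.

End FreeGroup.

HB.instance Definition _ (A : finType) :=
  isGroup.Build (fword A) (@fmulA A) (@fmul1 A) (@f1mul A) (@fmulVg A) (@fmulgV A).

Definition gen (A : finType) (x : letter A) : fword A := @FWord A [:: x] isT.

Record automorphism (A : finType) : Type := Automorphism {
  aut_fun :> {multiplicative fword A -> fword A};
  aut_inv : fword A -> fword A;
  autK : cancel aut_fun aut_inv;
  aut_invK : cancel aut_inv aut_fun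
}.

Definition stretch (A : finType) (phi : automorphism A) : nat :=
  \max_(a : A) maxn (size (phi (gen (a, true))))
                    (size (aut_inv phi (gen (a, true)))).

Record boundary (A : finType) : Type := Boundary {
  bletter :> nat -> letter A;
  boundaryP : forall i, bletter i.+1 != linv (bletter i)
}.

Lemma mkseq_reduced (A : finType) (x : boundary A) n : reduced (mkseq x n).
Proof.
case: n => // n; apply/(sortedP (x 0)) => i; rewrite size_mkseq => lt_i.
by rewrite !nth_mkseq ?boundaryP // ltnW.
Qed.

Definition bprefix (A : finType) (x : boundary A) (n : nat) : fword A :=
  FWord (mkseq_reduced x n).

Definition cylinder (A : finType) (u : fword A) : set (boundary A) :=
  [set x | bprefix x (size u) = u].

Definition cylinders (A : finType) (U : set (fword A)) : set (boundary A) :=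
  \bigcup_(u in U) cylinder u.

(* Convergence of a sequence of elements of F to a point of the Gromov boundary
   of F, in terms of reduced words. *)
Definition cvg_boundary (A : finType) (w : nat -> fword A) (y : boundary A) : Prop :=
  forall m, exists N, forall n, N <= n -> take m (w n) = bprefix y m.

Section InducedMap.
Variable A : finType.
Implicit Types (x y : letter A) (u v w : fword A) (phi : automorphism A).

Lemma cvg_boundary_unique (w : nat -> fword A) (y z : boundary A) :
  cvg_boundary w y -> cvg_boundary w z -> y = z.
Proof.
move=> wy wz; suff e : bletter y = bletter z.
  case: y z e {wy wz} => y yP [z zP] /= e; rewrite -{}e in zP *.
  by congr Boundary; apply: Prop_irrelevance.
apply: funext => i; have [N HN] := wy i.+1; have [M HM] := wz i.+1.
have := HN _ (leq_maxl N M); rewrite (HM _ (leq_maxr N M)) => /= e.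
by rewrite -(nth_mkseq (y i) y (ltnSn i)) -e nth_mkseq.
Qed.

Lemma mul_cancel u v :
  exists p c q, [/\ u = p ++ c :> seq _, v = winv c ++ q :> seq _
                  & (u * v)%g = p ++ q :> seq _].
Proof.
suff H (s : seq (letter A)) : reduced s -> exists p c q,
    [/\ s = p ++ c, v = winv c ++ q :> seq _ & reduce (s ++ v) = p ++ q].
  exact: H (fwordP u).
elim: s => [_|x s IH].
  by exists [::], [::], v; rewrite /= reduce_id // fwordP.
rewrite reduced_cons => /andP[xs /IH[[|y p] [c [q [e1 e2 e3]]]]].
- case: q e2 e3 => [|z q] e2 e3; rewrite /= in e1 e3; subst s.
    by exists [:: x], c, [::]; rewrite /= e3; split.
  case: (eqVneq z (linv x)) => zx.
    exists [::], (x :: c), q; rewrite /= e3 /= zx eqxx; split=> //.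
    by rewrite winv_cons cat_rcons -zx.
  by exists [:: x], c, (z :: q); rewrite /= e3 /= (negbTE zx); split.
- exists (x :: y :: p), c, q; split=> //=; first by rewrite e1.
  by rewrite e3 /=; move: xs; rewrite e1 /= => /negbTE ->.
Qed.

Lemma size_mul u v : size (u * v)%g <= size u + size v.
Proof.
have [p [c [q [-> -> ->]]]] := mul_cancel u v.
by rewrite !size_cat size_winv; apply: leq_add; rewrite ?leq_addr ?leq_addl.
Qed.

Lemma take_mul u v m : m + size v <= size u -> take m (u * v)%g = take m u.
Proof.
have [p [c [q [-> -> ->]]]] := mul_cancel u v.
rewrite !size_cat size_winv => le_m.
have mp : m <= size p.
  by rewrite -(leq_add2r (size c)); apply: leq_trans le_m; rewrite leq_add2l leq_addr.
by rewrite !takel_cat.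
Qed.

Lemma size_morph (f : fword A -> fword A) K :
  {morph f : u v / (u * v)%g} -> (forall a, size (f (gen (a, true))) <= K) ->
  forall w, size (f w) <= K * size w.
Proof.
move=> fM fK.
have f1 : f 1%g = 1%g by apply: (mulgI (f 1%g)); rewrite -fM !mulg1.
have fV w : f w^-1%g = (f w)^-1%g by apply: (mulgI (f w)); rewrite -fM !mulgV.
have fx x : size (f (gen x)) <= K.
  case: x => a [] //; rewrite (_ : gen (a, false) = (gen (a, true))^-1%g).
    by rewrite fV /= size_winv.
  exact: val_inj.
case; elim=> [|x w IH] rw.
  by rewrite (_ : FWord rw = 1%g) ?f1 //; apply: val_inj.
have rw' : reduced w by move: rw; rewrite reduced_cons => /andP[].
rewrite [f _](_ : _ = f (gen x * FWord rw')%g); last first.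
  by congr f; apply: val_inj; exact/esym/(@reduce_id A (x :: w)).
rewrite fM (leq_trans (size_mul _ _)) //=.
by rewrite mulnS leq_add.
Qed.

Lemma size_aut phi w : size (phi w) <= stretch phi * size w.
Proof.
apply: size_morph => [|a]; first exact: gmulfM.
have := leq_bigmax (F := fun a => maxn (size (phi (gen (a, true))))
  (size (aut_inv phi (gen (a, true))))) a.
by apply: leq_trans; apply: leq_maxl.
Qed.

Lemma size_aut_inv phi w : size (aut_inv phi w) <= stretch phi * size w.
Proof.
have M : {morph aut_inv phi : u v / (u * v)%g}.
  by move=> u v; apply: (can_inj (autK phi)); rewrite gmulfM !aut_invK.
apply: size_morph => [|a]; first exact: M.
have := leq_bigmax (F := fun a => maxn (size (phi (gen (a, true))))
  (size (aut_inv phi (gen (a, true))))) a.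
by apply: leq_trans; apply: leq_maxr.
Qed.

Lemma bprefixS (x : boundary A) n : bprefix x n.+1 = (bprefix x n * gen (x n))%g.
Proof.
apply: val_inj; rewrite /= [RHS](_ : _ = reduce (mkseq x n.+1)).
  by rewrite reduce_id // mkseq_reduced.
by rewrite mkseqS cats1.
Qed.

Lemma aut_boundary_cvg phi (x : boundary A) :
  exists y : boundary A, cvg_boundary (fun n => phi (bprefix x n)) y.
Proof.
set S := stretch phi; set w := fun n => phi (bprefix x n).
have size_w n : n <= S * size (w n).
  by have := size_aut_inv phi (w n); rewrite autK /= size_mkseq.
pose N m := (S * (m + S)).+1.
have leN m n : m <= n -> N m <= N n by move=> mn; rewrite ltnS leq_mul2l leq_add2r mn orbT.
have large m n : N m <= n -> m + S < size (w n).
  move=> /leq_trans/(_ (size_w n)) h; rewrite ltnNge; apply/negP => h'.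
  by have := leq_trans h (leq_mul (leqnn S) h'); rewrite ltnn.
have take_w m n : N m <= n -> take m (w n) = take m (w (N m)).
  elim: n => // n IH; rewrite leq_eqVlt => /predU1P[-> //|le_n].
  rewrite -{}IH // /w bprefixS gmulfM take_mul //.
  apply: leq_trans (ltnW (large _ _ le_n)); rewrite leq_add2l.
  by have := size_aut phi (gen (x n)); rewrite /= muln1.
pose y i := nth (x 0) (w (N i.+1)) i.
have yE m n i : i < m -> N m <= n -> nth (x 0) (w n) i = y i.
  move=> im mn; rewrite /y -(nth_take (x 0) (ltnSn i)) -[RHS](nth_take (x 0) (ltnSn i)).
  by rewrite take_w // (leq_trans (leN _ _ im)).
have yP i : y i.+1 != linv (y i).
  have /(sortedP (x 0)) w_red := fwordP (w (N i.+2)).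
  rewrite -(yE i.+2 (N i.+2) i) // w_red //.
  by apply: leq_trans (large _ _ (leqnn _)); rewrite leqW ?leq_addr.
exists (Boundary yP) => m; exists (N m) => n Nn.
have lt_m : m <= size (w n) by apply: leq_trans (ltnW (large _ _ Nn)); rewrite leq_addr.
apply: (@eq_from_nth _ (x 0)); first by rewrite size_takel // size_mkseq.
move=> i; rewrite size_takel // => im.
by rewrite nth_take // (yE m n) //= nth_mkseq.
Qed.

(* The extension of an automorphism to the Gromov boundary. *)
Definition boundary_map phi (x : boundary A) : boundary A :=
  sval (cid (aut_boundary_cvg phi x)).

Lemma boundary_mapP phi (x : boundary A) :
  cvg_boundary (fun n => phi (bprefix x n)) (boundary_map phi x).
Proof. exact: svalP (cid (aut_boundary_cvg phi x)). Qed.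

End InducedMap.

Lemma erase_reduced (A : finType) (l : nat) (w : fword A) :
  reduced (take (size w - l) w).
Proof. exact/take_sorted/fwordP. Qed.

(* Meaningful for l <= size w; it gives the empty word otherwise. *)
Definition erase (A : finType) (l : nat) (w : fword A) : fword A :=
  FWord (erase_reduced l w).

Definition extend (A : finType) (l : nat) (w : fword A) : set (fword A) :=
  [set w' | exists2 v : seq (letter A), size v = l & w' = w ++ v :> seq _].

Definition image_words (A : finType) (phi : automorphism A) (u : fword A) :
    set (fword A) :=
  let S := stretch phi in
  let k := S ^ 4 + S ^ 3 + S ^ 2 in
  [set erase (S ^ 2) (phi u') | u' in extend k u].

(* Total recursive functions between data types built from natural numbers,
   finite types, pairs and lists: the closure of the basic operations under
   composition, pairing, branching over a finite type, primitive recursion on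
   numbers and on lists, and minimisation. The rules never form a function
   type, and every function on a finite type is obtained by branching. *)
Inductive recursive : forall X Y : Type, (X -> Y) -> Prop :=
| rec_ext X Y (f g : X -> Y) : f =1 g -> recursive f -> recursive g
| rec_id X : recursive (@id X)
| rec_comp X Y Z (g : Y -> Z) (f : X -> Y) :
    recursive g -> recursive f -> recursive (fun x => g (f x))
| rec_pair X Y Z (f : X -> Y) (g : X -> Z) :
    recursive f -> recursive g -> recursive (fun x => (f x, g x))
| rec_fst X Y : recursive (@fst X Y)
| rec_snd X Y : recursive (@snd X Y)
| rec_const X (T : finType) (t : T) : recursive (fun _ : X => t)
| rec_case X Y (T : finType) (f : T -> X -> Y) :
    (forall t, recursive (f t)) -> recursive (fun p : T * X => f p.1 p.2)
| rec_zero X : recursive (fun _ : X => 0)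
| rec_succ : recursive S
| rec_nat X Y (f : X -> Y) (g : X * (nat * Y) -> Y) :
    recursive f -> recursive g ->
    recursive (fun p : X * nat =>
      nat_rect (fun=> Y) (f p.1) (fun n y => g (p.1, (n, y))) p.2)
| rec_nil X T : recursive (fun _ : X => [::] : seq T)
| rec_cons T : recursive (fun p : T * seq T => p.1 :: p.2)
| rec_list X Y T (f : X -> Y) (g : X * (T * (seq T * Y)) -> Y) :
    recursive f -> recursive g ->
    recursive (fun p : X * seq T =>
      list_rect (fun=> Y) (f p.1) (fun t s y => g (p.1, (t, (s, y)))) p.2)
| rec_min X (f : X * nat -> bool) (f_ex : forall x, exists n, f (x, n)) :
    recursive f -> recursive (fun x => ex_minn (f_ex x)).

(* The family of words f(a), for a in A, listed in the enumeration order of A. *)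
Definition gen_images (A : finType) (f : fword A -> fword A) :
    seq (seq (letter A)) :=
  [seq fword_seq (f (gen (a, true))) | a <- enum A].

(* Main.v *)
Require Import Defs.
From HB Require Import structures.
From mathcomp Require Import all_boot.
From mathcomp Require Import boolp classical_sets cardinality.

(* The key point is bounded cancellation with constant S^2, S = S(phi): if u and
   v have different first letters, a common prefix g of phi(u) and phi(v) has
   length at most S^2. The path of images of the prefixes of u makes steps of
   length at most S, so it passes at distance less than S from g; the same holds
   for v. In the Cayley tree phi^-1(g) is separated by 1 from u or from v, so
   the phi^-1-image of the short geodesic from g to the nearby image passes at
   distance less than S from 1, and applying phi again bounds |g| by
   S (S - 1) + (S - 1) <= S^2.
   Hence phi(x) starts with phi(u')|_{S^2} whenever x starts with u'. Applied to
   x in C_u and its prefix u' of length |u| + k, this gives one inclusion.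
   Applied to phi^-1 and y in C_{phi(u')|_{S^2}}, it gives the other: the word
   phi^-1(phi(u')|_{S^2}) agrees with u' except for the last S^3 letters, and
   bounded cancellation costs S^2 more, so phi^-1(y) still starts with u
   because |u'| - |u| >= S^3 + S^2. *)

Set Implicit Arguments.
Unset Strict Implicit.
Unset Printing Implicit Defensive.

Local Open Scope classical_set_scope.

(** * Multiplicative maps between groups *)

Section Morphisms.
Variables (G H : groupType) (f : G -> H) (fM : {morph f : u v / (u * v)%g}).

Lemma morph1 : f 1%g = 1%g.
Proof. by apply: (mulgI (f 1%g)); rewrite -fM !mulg1. Qed.

Lemma morphV : {morph f : u / u^-1%g}.
Proof. by move=> u; apply: (mulgI (f u)); rewrite -fM !mulgV morph1. Qed.

End Morphisms.

(** * Separation by the identity in the Cayley tree, and bounded cancellation *)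

Section BoundedCancellation.
Variable A : finType.
Implicit Types (x y : letter A) (g h t u v w : fword A) (phi : automorphism A).
Implicit Types f : fword A -> fword A.

(* The geodesic from [r] to [s] in the Cayley tree passes through the identity. *)
Definition apart (r s : seq (letter A)) : bool :=
  (ohead r == None) || (ohead r != ohead s).

Lemma apartC : commutative apart.
Proof.
by move=> [|x r] [|y s]; rewrite /apart //= eq_sym.
Qed.

(** Words that are not [apart] are nonempty with the same first letter, and having the same first
    letter is transitive. *)
Lemma apart_trans s r t : apart r t -> apart r s || apart s t.
Proof.
rewrite /apart; case: (ohead r) => //= x xt.
by case: eqP => //= <-; rewrite xt orbT.
Qed.

Lemma winv_cat (r s : seq (letter A)) : winv (r ++ s) = winv s ++ winv r.
Proof. by rewrite /winv map_cat rev_cat. Qed.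

Lemma winv_rcons (r : seq (letter A)) x : winv (rcons r x) = linv x :: winv r.
Proof. by rewrite -cats1 winv_cat. Qed.

Lemma apart_mul u v : apart u v -> (u^-1 * v)%g = winv u ++ v :> seq _.
Proof.
have [p [c [q [eu ev ->]]]] := mul_cancel u^-1%g v.
rewrite [winv u]eu ev; have {eu} -> : u = winv (p ++ c) :> seq _ by rewrite -eu winvK.
(* Both [u] and [v] begin with [winv c], so a nonempty [c] would give them the same first letter. *)
case: (lastP c) {ev} => [|r x]; first by rewrite cats0.
by rewrite winv_cat winv_rcons /apart /= eqxx.
Qed.

Lemma apart_size u v : apart u v -> size (u^-1 * v)%g = size u + size v.
Proof. by move=> /apart_mul ->; rewrite size_cat size_winv. Qed.

Lemma apart_prefix (r s r' s' : seq (letter A)) :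
  prefix r' r -> prefix s' s -> apart r s -> apart r' s'.
Proof.
move=> /prefixP[r1 ->] /prefixP[s1 ->].
by case: r' => // x r'; case: s'.
Qed.

(** The geodesic from 1 to [u] passes through its prefix [g]; left translation by the inverse of [g]
    moves this point to the identity. *)
Lemma prefix_apart g u : prefix g u -> apart (g^-1)%g (g^-1 * u)%g.
Proof.
case/prefixP => s us.
have rs : reduced s by move: (fwordP u); rewrite us => /cat_sorted2[].
have -> : u = (g * FWord rs)%g.
  by apply: val_inj; rewrite /= -us reduce_id // fwordP.
rewrite mulKg /apart /=; case: s us {rs} => [|y s] us; first by case: (ohead _).
have := fwordP u; rewrite us; case: (lastP g) => // r x.
rewrite winv_rcons /= cat_rcons.
move=> /cat_sorted2[_ /= /andP[yx _]].
by apply: contra_neq yx => -[].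
Qed.

(* A path whose steps have length at most [K] and whose geodesic passes through
   the identity comes within [K - 1] of the identity. *)
Lemma path_near_one f K h t :
  {morph f : u v / (u * v)%g} -> (forall x, size (f (gen x)) <= K) ->
  apart h (h * f t)%g ->
  exists2 t' : fword A, prefix t' t & size (h * f t')%g <= K.-1.
Proof.
move=> fM fK; have f1 := morph1 fM.
case: t => t; elim: t h => [|x t IH] h rt.
  rewrite (_ : FWord rt = 1%g) ?f1 ?mulg1; last exact: val_inj.
  rewrite /apart eqxx orbF => h0.
  by exists 1%g => //; rewrite f1 mulg1; case: h h0 => -[].
have rt' : reduced t by move: rt; rewrite reduced_cons => /andP[].
have et : FWord rt = (gen x * FWord rt')%g.
  by apply: val_inj; exact/esym/(@reduce_id A (x :: t)).
(* Either the first step, from [h] to [h * f (gen x)], is separated by the identity, or the rest of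
   the path is and induction applies from [h * f (gen x)]. *)
rewrite {1}et fM mulgA {et} => /(apart_trans (h * f (gen x))%g)/orP[hx|]; last first.
  move=> /IH[t' tt' le_t'].
  have rxt' : reduced (x :: t').
    by case/prefixP: tt' rt => s /= -> /=; rewrite cat_path => /andP[].
  exists (FWord rxt'); first by apply/andP.
  rewrite (_ : FWord rxt' = (gen x * t')%g) ?fM ?mulgA //.
  by apply: val_inj; exact/esym/(@reduce_id A (x :: t')).
(* The two ends of this step have lengths with sum at most [K]: either the second end is 1, or the
   first has length at most [K.-1]. *)
have := apart_size hx; rewrite mulKg => /(congr1 (leq^~ K)); rewrite fK => /esym.
case: (posnP (size (h * f (gen x))%g)) => [s0 _|s_gt0 le_K].
  by exists (gen x); [apply/andP; split=> //; apply: prefix0s | rewrite s0].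
exists 1%g; first by [].
rewrite f1 mulg1 -ltnS; apply: leq_trans (leqSpred K).
by apply: leq_trans le_K; rewrite -addn1 leq_add2l.
Qed.

Lemma aut_inv_morph phi : {morph aut_inv phi : u v / (u * v)%g}.
Proof. exact: can2_gmulfM (autK phi) (@aut_invK A phi). Qed.

Lemma bounded_cancellation phi g u v :
  apart u v -> prefix g (phi u) -> prefix g (phi v) -> size g <= stretch phi ^ 2.
Proof.
set S := stretch phi => uv gu gv.
have phiK x : size (phi (gen x)) <= S by have := size_aut phi (gen x); rewrite /= muln1.
have psiK x : size (aut_inv phi (gen x)) <= S.
  by have := size_aut_inv phi (gen x); rewrite /= muln1.
have near w : prefix g (phi w) ->
    exists2 w', prefix (fword_seq w') w & size (g^-1 * phi w')%g <= S.-1.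
  by move/prefix_apart; apply: path_near_one phiK; apply: gmulfM.
have [u' u'u le_u'] := near _ gu; have [v' v'v le_v'] := near _ gv.
have uv' := apart_prefix u'u v'v uv.
(* [phi^-1 g] points away from [u'] or from [v'], so the image of the short
   geodesic from [g] to [phi u'] or [phi v'] passes near the identity. *)
have far w : size (g^-1 * phi w)%g <= S.-1 -> apart (aut_inv phi g) w ->
    size g <= S ^ 2.
  move=> le_w gw; set t := (g^-1 * phi w)%g in le_w.
  have : apart (aut_inv phi g) (aut_inv phi g * aut_inv phi t)%g.
    by rewrite -aut_inv_morph /t mulVKg autK.
  case/(path_near_one (aut_inv_morph phi) psiK) => t' /size_prefix le_t'.
  rewrite -aut_inv_morph => le_gt'.
  (* Here [g * t'] has length at most [S * S.-1], as the image under [phi] of an element of length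
     at most [S.-1], and [t'] is no longer than [t]. *)
  have -> : g = (g * t' * t'^-1)%g by rewrite mulgK.
  apply: leq_trans (size_mul _ _) _; rewrite /= size_winv.
  have := size_aut phi (aut_inv phi (g * t')%g); rewrite aut_invK -/S => le_g.
  apply: (@leq_trans (S * S.-1 + S.-1)); last first.
    by case: (S) => // n; rewrite expnS expn1 [leqRHS]mulnS [leqRHS]addnC leq_add2l leqnSn.
  rewrite leq_add ?(leq_trans le_t') //.
  by apply: leq_trans le_g _; rewrite leq_mul2l le_gt' orbT.
have /orP[u'g|] := apart_trans (aut_inv phi g) uv'; last exact: far.
by apply: far le_u' _; rewrite apartC.
Qed.

End BoundedCancellation.

(** * The inverse automorphism *)

Section InverseAutomorphism.
Variables (A : finType) (phi : automorphism A).

HB.instance Definition _ := isMultiplicative.Build _ _ (aut_inv phi) (aut_inv_morph phi).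

Definition inverse_aut : automorphism A :=
  @Automorphism A (aut_inv phi) phi (@aut_invK A phi) (@autK A phi).

(** The maximum runs over images under both maps, so it is symmetric in them; every bound then holds
    for the inverse with the same constant. *)
Lemma stretch_inverse : stretch inverse_aut = stretch phi.
Proof. by apply: eq_bigr => a _; rewrite maxnC. Qed.

End InverseAutomorphism.

(** * Images of cylinders under the boundary homeomorphism *)

Section BoundaryMap.
Variable A : finType.
Implicit Types (x y : boundary A) (u v w : fword A) (phi : automorphism A).

Lemma take_bprefix x m n : m <= n -> take m (bprefix x n) = bprefix x m.
Proof. by move=> mn; rewrite /= /mkseq -map_take take_iota (minn_idPl mn). Qed.

Lemma cylinder_take u x m :
  cylinder u x -> m <= size u -> take m u = bprefix x m.
Proof. by move=> xu mu; rewrite -xu; apply: take_bprefix. Qed.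

Lemma boundary_ext x y : (forall n, bprefix x n = bprefix y n) -> x = y.
Proof.
move=> xy; apply: (@cvg_boundary_unique A (bprefix x)) => m; exists m => n mn.
  exact: take_bprefix.
by rewrite xy; apply: take_bprefix.
Qed.

Lemma size_erase l w : size (erase l w) = size w - l.
Proof. by rewrite /= size_takel // leq_subr. Qed.

Lemma take_erase m l w : m + l <= size w -> take m (erase l w) = take m w.
Proof. by move=> /(leq_sub2r l); rewrite addnK => ml; apply: take_takel. Qed.

(** The erased suffix has at most [l] letters, hence an image of length at most [stretch phi * l];
    multiplying by the inverse of this image can alter only that many last letters of [phi w]. *)
Lemma take_aut_erase phi l m w :
  m + stretch phi * l <= size (phi w) ->
  take m (phi (erase l w)) = take m (phi w).
Proof.
move=> le_m; have rt := drop_sorted (size w - l) (fwordP w).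
have we : w = (erase l w * FWord rt)%g.
  by apply: val_inj; rewrite /= cat_take_drop reduce_id // fwordP.
rewrite -[erase l w](mulgK (FWord rt)) -we gmulfM take_mul //.
apply: leq_trans le_m; rewrite leq_add2l (leq_trans (size_aut _ _)) //.
by rewrite leq_mul2l /= size_winv size_drop leq_subLR addnC -leq_subLR leqnn orbT.
Qed.

Lemma boundary_map_cylinder phi x u :
  cylinder u x -> cylinder (erase (stretch phi ^ 2) (phi u)) (boundary_map phi x).
Proof.
move=> xu; set e := erase _ _.
have [N /(_ _ (leq_maxl N (size u)))] := boundary_mapP phi x (size e).
set n := maxn N (size u) => xn; apply/val_inj/(etrans (esym xn)).
have un : prefix u (bprefix x n).
  by rewrite prefixE take_bprefix ?leq_maxr // xu.
have /(@bounded_cancellation A phi) bc := prefix_apart un.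
(* The cancelled part [c] yields a common prefix [winv c] of the images of two elements that are
   [apart], so bounded cancellation limits its length. *)
have := mul_cancel (phi u) (phi (u^-1 * bprefix x n)%g).
rewrite -gmulfM mulVKg => -[p [c [q [ep ec ->]]]].
have rc : reduced (winv c).
  by move: (fwordP (phi (u^-1 * bprefix x n)%g)); rewrite ec => /cat_sorted2[].
have le_c : size c <= stretch phi ^ 2.
  rewrite -size_winv; apply: (bc (FWord rc)); last by rewrite ec prefix_prefix.
  by rewrite (morphV (@gmulfM _ _ phi)) /= ep winv_cat prefix_prefix.
have le_e : size e <= size p by rewrite size_erase ep size_cat leq_subLR addnC leq_add2r.
rewrite takel_cat // -(takel_cat c le_e) -ep {1}size_erase //.
Qed.

(** This supplies preimages: for the second inclusion it remains to locate
    [boundary_map (inverse_aut phi) y] in the cylinder of [u]. *)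
Lemma boundary_map_invK phi : cancel (boundary_map (inverse_aut phi)) (boundary_map phi).
Proof.
move=> y; set psi := inverse_aut phi; set x := boundary_map psi y.
apply: boundary_ext => m; apply: val_inj.
(* Erasing [S ^ 2] letters before applying [phi] costs up to [S ^ 3] letters of the image, and the
   cylinder bound for [phi] costs [S ^ 2] more; [m] letters remain. *)
set S := stretch phi; pose M := m + S ^ 2 + S ^ 3.
pose e := erase (S ^ 2) (psi (bprefix y M)).
have xe : cylinder e x.
  rewrite /e -[S]stretch_inverse; apply: boundary_map_cylinder.
  by rewrite /cylinder /= size_mkseq.
have eM : take (m + S ^ 2) (phi e) = take (m + S ^ 2) (bprefix y M).
  by rewrite take_aut_erase aut_invK //= size_mkseq.
(* The truncation of [phi e] has the full length [m + S ^ 2], so [phi e] is at least that long. *)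
have le_e : m + S ^ 2 <= size (phi e).
  move/(congr1 size): eM; rewrite take_bprefix ?leq_addr // size_mkseq => <-.
  by rewrite size_take; case: ltnP => // /ltnW.
apply: etrans (esym (cylinder_take (boundary_map_cylinder phi xe) _)) _.
  by rewrite size_erase; move/(leq_sub2r (S ^ 2)): le_e; rewrite addnK.
rewrite take_erase // -(take_takel _ (leq_addr (S ^ 2) m)) eM.
by rewrite take_takel ?leq_addr // take_bprefix // /M -addnA leq_addr.
Qed.

Lemma boundary_map_image_words phi u :
  boundary_map phi @` cylinder u = cylinders (image_words phi u).
Proof.
rewrite /cylinders /image_words; set S := stretch phi; set k := S ^ 4 + _ + _.
apply/seteqP; split=> [_ [x xu <-]|y [_ [u' [v szv u'E] <-] yu']].
  (* First inclusion: [u'] is the prefix of [x] of length [size u + k]. *)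
  exists (erase (S ^ 2) (phi (bprefix x (size u + k)))); last first.
    by apply: boundary_map_cylinder; rewrite /cylinder /= size_mkseq.
  exists (bprefix x (size u + k)) => //.
  exists (drop (size u) (bprefix x (size u + k))).
    by rewrite size_drop size_mkseq addKn.
  by rewrite -{2}xu -(take_bprefix x (leq_addr k (size u))) cat_take_drop.
exists (boundary_map (inverse_aut phi) y); last exact: boundary_map_invK.
set w := erase (S ^ 2) (phi u') in yu'.
have xw := boundary_map_cylinder (inverse_aut phi) yu'.
(* The [S ^ 2] letters erased in [w] affect at most [S ^ 3] final letters of [u'], and
   [k >= S ^ 3 + S ^ 2]. *)
have wE : take (size u + S ^ 2) (inverse_aut phi w) = take (size u + S ^ 2) u'.
  rewrite take_aut_erase /= autK // u'E size_cat szv stretch_inverse -/S.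
  by rewrite -addnA leq_add2l -expnS addnC /k -addnA leq_addl.
have le_w : size u + S ^ 2 <= size (inverse_aut phi w).
  move/(congr1 size): wE; rewrite [in RHS]size_takel; last first.
    by rewrite u'E size_cat szv leq_add2l leq_addl.
  by move=> <-; rewrite size_take; case: ltnP => // /ltnW.
apply/val_inj/(etrans (esym (cylinder_take xw _))); rewrite stretch_inverse -/S.
  by rewrite size_erase; move/(leq_sub2r (S ^ 2)): le_w; rewrite addnK.
rewrite take_erase // -(take_takel _ (leq_addr (S ^ 2) (size u))) wE.
by rewrite take_takel ?leq_addr // u'E take_size_cat.
Qed.

End BoundaryMap.

(** * Closure properties of the recursive functions *)

Lemma rec_fst_of X Y Z (f : X -> Y * Z) : recursive f -> recursive (fun x => (f x).1).
Proof. exact: rec_comp (@rec_fst _ _). Qed.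

Lemma rec_snd_of X Y Z (f : X -> Y * Z) : recursive f -> recursive (fun x => (f x).2).
Proof. exact: rec_comp (@rec_snd _ _). Qed.

(** Handles composites of projections: parameters and recursion variables travel together in nested
    pairs. *)
Ltac rec_proj :=
  cbv beta; repeat first [apply: rec_fst_of | apply: rec_snd_of]; exact: rec_id.

Section RecursiveCombinators.
Variable X : Type.

Lemma rec_comp2 Y Z W (g : Y -> Z -> W) (f1 : X -> Y) (f2 : X -> Z) :
  recursive (fun p => g p.1 p.2) -> recursive f1 -> recursive f2 ->
  recursive (fun x => g (f1 x) (f2 x)).
Proof. by move=> rg r1 r2; apply: rec_comp rg (rec_pair r1 r2). Qed.

Lemma rec_case_of Y (T : finType) (f : T -> X -> Y) (t : X -> T) :
  (forall i, recursive (f i)) -> recursive t -> recursive (fun x => f (t x) x).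
Proof. by move=> rf rt; apply: rec_comp (rec_case rf) (rec_pair rt (rec_id X)). Qed.

(** Branching over the value of [t] leaves only constants. *)
Lemma rec_fin (T T' : finType) (f : T -> T') (t : X -> T) :
  recursive t -> recursive (fun x => f (t x)).
Proof. by apply: (rec_case_of (f := fun i _ => f i)) => i; apply: rec_const. Qed.

Lemma rec_fin2 (T1 T2 T' : finType) (f : T1 -> T2 -> T') (t1 : X -> T1) (t2 : X -> T2) :
  recursive t1 -> recursive t2 -> recursive (fun x => f (t1 x) (t2 x)).
Proof.
move=> r1 r2.
exact: (rec_fin (T := (T1 * T2)%type) (fun p => f p.1 p.2) (rec_pair r1 r2)).
Qed.

Lemma rec_if Y (b : X -> bool) (f g : X -> Y) :
  recursive b -> recursive f -> recursive g ->
  recursive (fun x => if b x then f x else g x).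
Proof.
move=> rb rf rg.
by apply: (rec_case_of (f := fun i x => if i then f x else g x)) rb => -[].
Qed.

Lemma rec_iter Y (n : X -> nat) (f : X -> Y -> Y) (z : X -> Y) :
  recursive n -> recursive (fun p => f p.1 p.2) -> recursive z ->
  recursive (fun x => iter (n x) (f x) (z x)).
Proof.
move=> rn rf rz.
have rg : recursive (fun p : X * (nat * Y) => f p.1 p.2.2).
  apply: (rec_comp rf (f := fun p => (p.1, p.2.2))).
  by apply: rec_pair; rec_proj.
apply: rec_ext (rec_comp (rec_nat rz rg) (rec_pair (rec_id X) rn)) => x /=.
by elim: (n x) => //= m ->.
Qed.

Lemma rec_succ_of (m : X -> nat) : recursive m -> recursive (fun x => (m x).+1).
Proof. exact: rec_comp rec_succ. Qed.

Lemma rec_cons_of T (t : X -> T) (s : X -> seq T) :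
  recursive t -> recursive s -> recursive (fun x => t x :: s x).
Proof. exact: rec_comp2 (@rec_cons T). Qed.

Lemma rec_foldr T Y (f : X -> T -> Y -> Y) (z : X -> Y) (s : X -> seq T) :
  recursive (fun p => f p.1 p.2.1 p.2.2) -> recursive z -> recursive s ->
  recursive (fun x => foldr (f x) (z x) (s x)).
Proof.
move=> rf rz rs.
have rg : recursive (fun p : X * (T * (seq T * Y)) => f p.1 p.2.1 p.2.2.2).
  apply: (rec_comp rf (f := fun p => (p.1, (p.2.1, p.2.2.2)))).
  by do 2?apply: rec_pair; rec_proj.
apply: rec_ext (rec_comp (rec_list rz rg) (rec_pair (rec_id X) rs)) => x /=.
by elim: (s x) => //= t r ->.
Qed.

Lemma rec_const_seq (T : finType) (s : seq T) : @recursive X (seq T) (fun=> s).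
Proof.
elim: s => [|t s IH]; first exact: rec_nil.
by apply: rec_cons_of IH; apply: rec_const.
Qed.

Lemma rec_const_nat n : @recursive X nat (fun=> n).
Proof. by elim: n => [|n IH]; [apply: rec_zero | apply: rec_succ_of]. Qed.

End RecursiveCombinators.

Lemma rec_addn X (m n : X -> nat) : recursive m -> recursive n -> recursive (fun x => m x + n x).
Proof.
move=> rm rn; apply: (@rec_ext _ _ (fun x => iter (m x) succn (n x))).
  by move=> x; rewrite iter_succn addnC.
by apply: rec_iter rm _ rn; apply: rec_succ_of; rec_proj.
Qed.

Lemma rec_pred X (n : X -> nat) : recursive n -> recursive (fun x => (n x).-1).
Proof.
move=> rn; apply: (rec_comp (g := predn) _ rn).
(* The step returns the counter, which is the predecessor of the number reached; [unit] is a dummy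
   parameter. *)
have rg : recursive (fun p : unit * (nat * nat) => p.2.1) by rec_proj.
apply: rec_ext (rec_comp (rec_nat (rec_zero unit) rg)
  (rec_pair (rec_const nat tt) (rec_id nat))) => k /=.
by case: k.
Qed.

Lemma rec_subn X (m n : X -> nat) : recursive m -> recursive n -> recursive (fun x => m x - n x).
Proof.
move=> rm rn; apply: (@rec_ext _ _ (fun x => iter (n x) predn (m x))).
  by move=> x; rewrite iter_predn.
by apply: rec_iter rn _ rm; apply: rec_pred; rec_proj.
Qed.

Lemma rec_maxn X (m n : X -> nat) : recursive m -> recursive n -> recursive (fun x => maxn (m x) (n x)).
Proof.
move=> rm rn; apply: (@rec_ext _ _ (fun x => m x + (n x - m x))).
  by move=> x; rewrite maxnE.
by apply: rec_addn => //; apply: rec_subn.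
Qed.

Lemma rec_muln X (m n : X -> nat) :
  recursive m -> recursive n -> recursive (fun x => m x * n x).
Proof.
move=> rm rn; apply: (@rec_ext _ _ (fun x => iter (n x) (addn (m x)) 0)).
  by move=> x; rewrite iter_addn_0.
apply: rec_iter rn _ (@rec_zero X).
by apply: rec_addn; [apply: rec_comp rm (@rec_fst _ _) | rec_proj].
Qed.

Lemma rec_expn X (m : X -> nat) n : recursive m -> recursive (fun x => m x ^ n).
Proof.
move=> rm; elim: n => [|n IH]; first exact: rec_const_nat.
apply: (@rec_ext _ _ (fun x => m x * m x ^ n)); first by move=> x; rewrite expnS.
exact: rec_muln.
Qed.

Lemma rec_size X T (s : X -> seq T) : recursive s -> recursive (fun x => size (s x)).
Proof.
move=> rs; apply: (@rec_ext _ _ (fun x => foldr (fun _ n => n.+1) 0 (s x))).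
  by move=> x; elim: (s x) => //= t r ->.
by apply: rec_foldr (@rec_zero X) rs; apply: rec_succ_of; rec_proj.
Qed.

Lemma rec_cat X T (s1 s2 : X -> seq T) : recursive s1 -> recursive s2 -> recursive (fun x => s1 x ++ s2 x).
Proof.
move=> r1 r2; apply: (@rec_ext _ _ (fun x => foldr cons (s2 x) (s1 x))).
  by move=> x; elim: (s1 x) => //= t r ->.
by apply: rec_foldr r2 r1; apply: rec_cons_of; rec_proj.
Qed.

Lemma rec_behead X T (s : X -> seq T) : recursive s -> recursive (fun x => behead (s x)).
Proof.
move=> rs; apply: (rec_comp (g := behead) _ rs).
have rg : recursive (fun p : unit * (T * (seq T * seq T)) => p.2.2.1) by rec_proj.
apply: rec_ext (rec_comp (rec_list (rec_nil unit T) rg)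
  (rec_pair (rec_const _ tt) (rec_id (seq T)))) => r /=.
by case: r.
Qed.

Lemma rec_drop X T (n : X -> nat) (s : X -> seq T) :
  recursive n -> recursive s -> recursive (fun x => drop (n x) (s x)).
Proof.
move=> rn rs; apply: (@rec_ext _ _ (fun x => iter (n x) behead (s x))).
  by move=> x; rewrite drop_behead.
apply: rec_iter rn _ rs.
by apply: rec_behead; rec_proj.
Qed.

Lemma rec_map X T T' (f : X -> T -> T') (s : X -> seq T) :
  recursive (fun p => f p.1 p.2) -> recursive s ->
  recursive (fun x => [seq f x t | t <- s x]).
Proof.
move=> rf rs; apply: (@rec_ext _ _ (fun x => foldr (fun t r => f x t :: r) [::] (s x))).
  by move=> x; elim: (s x) => //= t r ->.
apply: rec_foldr (rec_nil _ _) rs; apply: rec_cons_of; last by rec_proj.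
by apply: (rec_comp rf (f := fun p => (p.1, p.2.1))); apply: rec_pair; rec_proj.
Qed.

Lemma rec_filter X T (a : X -> T -> bool) (s : X -> seq T) :
  recursive (fun p => a p.1 p.2) -> recursive s ->
  recursive (fun x => [seq t <- s x | a x t]).
Proof.
move=> ra rs.
apply: (@rec_ext _ _ (fun x => foldr (fun t r => if a x t then t :: r else r) [::] (s x))).
  by move=> x; elim: (s x) => //= t r ->.
apply: rec_foldr (rec_nil _ _) rs; apply: rec_if; last by rec_proj.
  by apply: (rec_comp ra (f := fun p => (p.1, p.2.1))); apply: rec_pair; rec_proj.
by apply: rec_cons_of; rec_proj.
Qed.

Lemma rec_flatten X T (s : X -> seq (seq T)) :
  recursive s -> recursive (fun x => flatten (s x)).
Proof. by apply: rec_foldr (rec_nil _ _); apply: rec_cat; rec_proj. Qed.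

Lemma rec_rev X T (s : X -> seq T) : recursive s -> recursive (fun x => rev (s x)).
Proof.
move=> rs; apply: (@rec_ext _ _ (fun x => foldr (fun t r => r ++ [:: t]) [::] (s x))).
  by move=> x; elim: (s x) => //= t r ->; rewrite rev_cons cats1.
apply: rec_foldr (rec_nil _ _) rs; apply: rec_cat; first by rec_proj.
by apply: rec_cons_of (rec_nil _ _); rec_proj.
Qed.

Lemma rec_nth X T (d : X -> T) (s : X -> seq T) n :
  recursive d -> recursive s -> recursive (fun x => nth (d x) (s x) n).
Proof.
(* A fold that discards its recursive value returns the head, or the default on the empty list. *)
move=> rd rs; apply: (@rec_ext _ _ (fun x => foldr (fun t _ => t) (d x) (drop n (s x)))).
  by move=> x; rewrite -[n in RHS]addn0 -nth_drop; case: (drop n _).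
by apply: rec_foldr rd _; [rec_proj | apply: rec_drop rs; apply: rec_const_nat].
Qed.

(** * The algorithm that lists the set U *)

Section Algorithm.
Variable A : finType.
Implicit Types (w : seq (letter A)) (L : seq (seq (letter A))).

Lemma rec_linv X (t : X -> letter A) : recursive t -> recursive (fun x => linv (t x)).
Proof. exact: rec_fin. Qed.

Lemma rec_winv X (w : X -> seq (letter A)) :
  recursive w -> recursive (fun x => winv (w x)).
Proof.
by move=> rw; apply: rec_rev; apply: rec_map rw; apply: rec_linv; rec_proj.
Qed.

(** The test on the head that decides cancellation, written as a fold so that it is covered by
    [rec_foldr]. *)
Definition starts_with_inv (x : letter A) w : bool := foldr (fun y _ => y == linv x) false w.

Lemma rec_starts_with_inv X (t : X -> letter A) (w : X -> seq (letter A)) :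
  recursive t -> recursive w -> recursive (fun x => starts_with_inv (t x) (w x)).
Proof.
move=> rt rw; apply: rec_foldr (rec_const _ _) rw.
apply: (rec_fin2 (fun x y : letter A => y == linv x)); last by rec_proj.
by apply: (rec_comp rt); rec_proj.
Qed.

Lemma rec_reduced X (w : X -> seq (letter A)) :
  recursive w -> recursive (fun x => reduced (w x)).
Proof.
move=> rw; apply: (rec_comp (g := @reduced A)) rw.
have rg : recursive (fun p : unit * (letter A * (seq (letter A) * bool)) =>
    if p.2.2.2 then ~~ starts_with_inv p.2.1 p.2.2.1 else false).
  apply: rec_if; [by rec_proj | | exact: rec_const].
  by apply: (rec_fin negb); apply: rec_starts_with_inv; rec_proj.
apply: rec_ext (rec_comp (rec_list (rec_const unit true) rg)
  (rec_pair (rec_const _ tt) (rec_id (seq (letter A))))) => r.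
elim: r => // x r /= ->; case: r => [|y r] //=.
by case: (path _ y r); rewrite ?andbT ?andbF.
Qed.

Lemma rec_reduce X (w : X -> seq (letter A)) :
  recursive w -> recursive (fun x => reduce (w x)).
Proof.
apply: rec_foldr (rec_nil _ _).
apply: (@rec_ext _ _ (fun p : X * (letter A * seq (letter A)) =>
  if starts_with_inv p.2.1 p.2.2 then behead p.2.2 else p.2.1 :: p.2.2)).
  by case=> x [t [|y w']].
apply: rec_if; first by apply: rec_starts_with_inv; rec_proj.
  by apply: rec_behead; rec_proj.
by apply: rec_cons_of; rec_proj.
Qed.

(** [L] tabulates the images of the basis in the order of [enum A]; a formal inverse receives the
    inverse word. *)
Definition letter_image L (x : letter A) : seq (letter A) :=
  let w := nth [::] L (index x.1 (enum A)) in if x.2 then w else winv w.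

Lemma rec_letter_image X (L : X -> seq (seq (letter A))) (t : X -> letter A) :
  recursive L -> recursive t -> recursive (fun x => letter_image (L x) (t x)).
Proof.
(* Branching over the letter turns its index into a constant, as [rec_nth] requires. *)
move=> rL; apply: (rec_case_of (f := fun i x => letter_image (L x) i)) => -[a b].
have rn : recursive (fun x => nth [::] (L x) (index a (enum A))).
  exact: rec_nth (rec_nil _ _) rL.
by case: b => //; apply: rec_winv.
Qed.

Definition word_image L w := reduce (flatten [seq letter_image L x | x <- w]).

Lemma rec_word_image X (L : X -> seq (seq (letter A))) (w : X -> seq (letter A)) :
  recursive L -> recursive w -> recursive (fun x => word_image (L x) (w x)).
Proof.
move=> rL rw; apply: rec_reduce; apply: rec_flatten; apply: rec_map rw.
by apply: rec_letter_image; [apply: (rec_comp rL); rec_proj | rec_proj].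
Qed.

Lemma word_imageE (f : fword A -> fword A) (w : fword A) :
  {morph f : u v / (u * v)%g} -> word_image (gen_images f) w = f w.
Proof.
move=> fM; rewrite /word_image.
have fx x : letter_image (gen_images f) x = f (gen x).
  rewrite /letter_image /gen_images (nth_map x.1) ?index_mem ?mem_enum //.
  rewrite nth_index ?mem_enum //; case: x => a [] //=.
  rewrite (_ : gen (a, false) = (gen (a, true))^-1%g); last exact: val_inj.
  by rewrite (morphV fM).
rewrite (eq_map fx); case: w; elim=> [|x w IH] rw /=.
  by rewrite (_ : FWord rw = 1%g) ?(morph1 fM) //; apply: val_inj.
have rw' : reduced w by move: rw; rewrite reduced_cons => /andP[].
rewrite -reduce_catr (IH rw') (_ : FWord rw = (gen x * FWord rw')%g) ?fM //.
by apply: val_inj; exact/esym/(@reduce_id A (x :: w)).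
Qed.

Definition max_size L := foldr maxn 0 [seq size w | w <- L].

Lemma rec_max_size X (L : X -> seq (seq (letter A))) :
  recursive L -> recursive (fun x => max_size (L x)).
Proof.
move=> rL; apply: rec_foldr (@rec_zero X) (rec_map _ rL).
  by apply: rec_maxn; rec_proj.
by apply: rec_size; rec_proj.
Qed.

Lemma max_sizeE (f : fword A -> fword A) :
  max_size (gen_images f) = \max_(a : A) size (f (gen (a, true))).
Proof.
by rewrite /max_size foldrE /gen_images -map_comp big_map big_enum.
Qed.

Lemma stretchE (phi : automorphism A) :
  stretch phi = maxn (max_size (gen_images phi)) (max_size (gen_images (aut_inv phi))).
Proof. by rewrite !max_sizeE /stretch big_split. Qed.

(** Non-reduced words are listed too: reducedness is tested only after [u] has been prepended, which
    also covers the junction. *)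
Definition words k : seq (seq (letter A)) :=
  iter k (fun ws => flatten [seq [seq x :: w | w <- ws] | x <- enum {: letter A}]) [:: [::]].

Lemma rec_words X (k : X -> nat) : recursive k -> recursive (fun x => words (k x)).
Proof.
move=> rk; apply: rec_iter rk _ (rec_cons_of (rec_nil _ _) (rec_nil _ _)).
apply: rec_flatten; apply: rec_map; last exact: rec_const_seq.
by apply: rec_map; [apply: rec_cons_of; rec_proj | rec_proj].
Qed.

Lemma mem_words k w : (w \in words k) = (size w == k).
Proof.
elim: k w => [|k IH] w /=; first by rewrite inE; case: w.
apply/flattenP/idP => [[_ /mapP[x _ ->] /mapP[v vk ->]]|].
  by rewrite /= eqSS -IH.
case: w => // x w; rewrite eqSS -IH => wk.
exists [seq x :: v | v <- words k]; last exact: map_f.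
by apply: (map_f (fun y => [seq y :: v | v <- words k])); rewrite mem_enum.
Qed.

(* [rev (drop l (rev w))] erases the last [l] letters of [w]. *)
Definition image_algorithm
    (d : seq (letter A) * (seq (seq (letter A)) * seq (seq (letter A)))) :=
  let S := maxn (max_size d.2.1) (max_size d.2.2) in
  [seq rev (drop (S ^ 2) (rev (word_image d.2.1 w)))
     | w <- [seq w <- [seq d.1 ++ v | v <- words (S ^ 4 + S ^ 3 + S ^ 2)] | reduced w]].

Lemma rec_image_algorithm : recursive image_algorithm.
Proof.
have rS : recursive (fun d : seq (letter A) * (seq (seq (letter A)) * seq (seq (letter A))) =>
    maxn (max_size d.2.1) (max_size d.2.2)).
  by apply: rec_maxn; apply: rec_max_size; rec_proj.
apply: rec_map.
  apply: rec_rev; apply: rec_drop.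
    by apply: rec_expn; apply: (rec_comp rS); rec_proj.
  by apply: rec_rev; apply: rec_word_image; rec_proj.
apply: rec_filter; first by apply: rec_reduced; rec_proj.
apply: rec_map; first by apply: rec_cat; rec_proj.
by apply: rec_words; do 2?apply: rec_addn; apply: rec_expn.
Qed.

(** The output lists exactly the set U, which gives both its finiteness and its computability. *)
Lemma image_algorithmE (phi : automorphism A) (u : fword A) :
  exists2 Us : seq (fword A),
    [seq fword_seq v | v <- Us] =
      image_algorithm (fword_seq u, (gen_images phi, gen_images (aut_inv phi)))
    & [set` Us] = image_words phi u.
Proof.
rewrite /image_algorithm -stretchE /image_words /=; set S := stretch phi; set k := _ + _ + _.
set ws := [seq w <- _ | _].
(* All words in [ws] passed the filter, so [insub] lifts each of them to [fword A] and none is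
   lost. *)
have [us usE] : exists us : seq (fword A), [seq fword_seq v | v <- us] = ws.
  exists (pmap insub ws); rewrite pmap_filter; last exact: insubK.
  by rewrite -filter_predI; apply: eq_filter => w /=; rewrite isSome_insub andbb.
exists [seq erase (S ^ 2) (phi v) | v <- us].
  rewrite -usE -!map_comp; apply: eq_map => w /=.
  by rewrite word_imageE ?drop_rev ?revK //; apply: gmulfM.
have usP (w : fword A) : w \in us <-> extend k u w.
  rewrite -(mem_map val_inj) usE mem_filter fwordP /=.
  split=> [/mapP[v] | [v szv ->]]; rewrite ?mem_words.
    by move/eqP; exists v.
  by apply: map_f; rewrite mem_words szv.
apply/seteqP; split=> [_ /mapP[w /usP uw ->]|_ [w /usP uw <-]]; first by exists w.
exact: map_f.
Qed.

End Algorithm.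

Theorem theorem1p2 (A : finType) (A_gt1 : 1 < #|A|) :
  (forall (phi : automorphism A) (u : fword A),
     exists2 U : set (fword A), finite_set U &
       boundary_map phi @` cylinder u = cylinders U)
  /\
  (exists2 alg : seq (letter A) * (seq (seq (letter A)) * seq (seq (letter A))) ->
                 seq (seq (letter A)),
     recursive alg &
     forall (phi : automorphism A) (u : fword A),
       exists Us : seq (fword A),
         [/\ [seq fword_seq w | w <- Us] =
               alg (fword_seq u, (gen_images phi, gen_images (aut_inv phi))),
             [set` Us] = image_words phi u
           & boundary_map phi @` cylinder u = cylinders (image_words phi u)]).
Proof.
split=> [phi u|].
  (* The explicit set of (b) also serves for (a). *)
  exists (image_words phi u); last exact: boundary_map_image_words.
  have [Us _ <-] := image_algorithmE phi u; exact: finite_seq.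
exists (@image_algorithm A) => [|phi u]; first exact: rec_image_algorithm.
have [Us UsE UsP] := image_algorithmE phi u.
by exists Us; split=> //; apply: boundary_map_image_words.
Qed.
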